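(* (a) Given $s_{\min}\in(0,s_{\max}]$, $b>0$, $0<b_1\le b_2$ and $j_1\ge j_0$, there exist $M>0$, $\varepsilon\in(0,1)$ and $\rho\in\mathbb N$ such that, for any $s\in[s_{\min},s_{\max}]$, the condition $$f\in C^s\cap C^{s_{\min}}(b),\qquad b_12^{-js}\le\|f_{j+1,\infty}\|_\infty\le b_22^{-js}\quad\text{for all } j\ge j_1,\qquad(\ast)$$ implies $f\in C^s_0(M,\varepsilon,\rho)$. (b) Conversely, given $s\in(0,s_{\max}]$, $M>0$, $\varepsilon\in(0,1)$ and an integer $\rho>1$, there exists $f\in C^s_0(M,\varepsilon,\rho)$ which does not satisfy condition $(\ast)$ (with this $s$) for any $s_{\min}\in(0,s]$, $b>0$, $0<b_1\le b_2$ and $j_1\ge j_0$.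
   Context: Wavelet basis: $\varphi,\psi$ are the scaling function and wavelet of an orthonormal multiresolution analysis of $L^2(\mathbb R)$ such that, for some $K,N\in\mathbb N$: $\varphi,\psi$ are supported in $[1-K,K]$; $\int x^i\psi(x)\,dx=0$ for $i=0,\dots,N-1$; $\varphi$ is twice continuously differentiable. From these, the Cohen–Daubechies–Vial boundary-corrected construction gives an orthonormal basis of $L^2([0,1])$ consisting of $\varphi_{j_0,k}$, $0\le k<2^{j_0}$, and $\psi_{j,k}$, $j\ge j_0$, $0\le k<2^j$, for a suitable fixed coarsest level $j_0>0$. For $k\in[N,2^j-N)$ the functions are $\varphi_{j_0,k}(x)=2^{j_0/2}\varphi(2^{j_0}x-k)$ and $\psi_{j,k}(x)=2^{j/2}\psi(2^jx-k)$; for the other $k$ they are the boundary functions of that construction. For $f=\sum_k\alpha_k\varphi_{j_0,k}+\sum_{j\ge j_0}\sum_k\beta_{j,k}\psi_{j,k}\in L^2([0,1])$ and $s\in(0,N)$ put $\|f\|_{C^s}:=\max\big(\sup_k|\alpha_k|,\ \sup_{j,k}2^{j(s+1/2)}|\beta_{j,k}|\big)$, $C^s:=\{f\in L^2([0,1]):\|f\|_{C^s}<\infty\}$ and $C^s(M):=\{f\in L^2([0,1]):\|f\|_{C^s}\le M\}$. Set $f_{i,j}:=\sum_{l=i}^j\sum_k\beta_{l,k}\psi_{l,k}$ for $i>j_0$ (with $j=\infty$ allowed), and $f_{j_0,j}:=\sum_k\alpha_k\varphi_{j_0,k}+\sum_{l=j_0}^j\sum_k\beta_{l,k}\psi_{l,k}$.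 $\|\cdot\|_\infty$ is the supremum norm on $[0,1]$. Self-similar functions: fix $s_{\max}\in(0,N)$. For $s\in(0,s_{\max})$, $M>0$, $\varepsilon\in(0,1)$, $\rho\in\mathbb N$, $C^s_0(M,\varepsilon,\rho)$ is the set of $f\in C^s(M)$ with $\|f_{j,\rho j}\|_{C^s}\ge\varepsilon M$ for all $j\ge j_0$. For $s=s_{\max}$, $C^{s_{\max}}_0(M,\varepsilon,\rho)$ is the set of $f\in C^{s_{\max}}(M)$ for which this inequality holds for $j=j_0$ only. *)

(* Defs.v *)
From HB Require Import structures.
From mathcomp Require Import all_boot all_order all_algebra.
From mathcomp Require Import all_classical all_reals all_analysis.

Set Implicit Arguments.
Unset Strict Implicit.
Unset Printing Implicit Defensive.

Import Order.TTheory GRing.Theory Num.Theory.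
Import numFieldNormedType.Exports.
Local Open Scope classical_set_scope.
Local Open Scope ring_scope.

Section L2.
Context {R : realType}.
Implicit Types (D : set R) (f g : R -> R) (V : set (R -> R)).

Local Notation mu := (@lebesgue_measure R).

(* Elements of L^2(D) are represented by functions [R -> R], of which only the
   restriction to D, up to null sets, matters. *)
Definition L2 D : set (R -> R) :=
  [set f : R -> R | measurable_fun D f /\ (\int[mu]_(x in D) ((f x) ^+ 2)%:E < +oo)%E].

Definition ip D f g : R := \int[mu]_(x in D) (f x * g x).

Definition ae_eq_on D f g : Prop :=
  {ae mu, forall x, D x -> f x = g x}.

Record closed_subspace D V : Prop := {
  closed_subspace_L2 : V `<=` L2 D;
  closed_subspace0 : V (fun=> 0);
  closed_subspaceD : forall (a : R) f g,
    V f -> V g -> V (fun x => a * f x + g x);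
  closed_subspace_lim : forall (u : nat -> R -> R) f,
    (forall n, V (u n)) -> L2 D f ->
    ip D (f \- u n) (f \- u n) @[n --> \oo] --> (0 : R) -> V f }.

(* The family is indexed by the elements of the subset [A] of [I]. *)
Definition orthonormal D {I : Type} (A : set I) (e : I -> R -> R) : Prop :=
  [/\ forall i, A i -> L2 D (e i),
      forall i, A i -> ip D (e i) (e i) = 1
    & forall i i', A i -> A i' -> i <> i' -> ip D (e i) (e i') = 0].

Definition orthonormal_basis D V {I : Type} (A : set I) (e : I -> R -> R) :
    Prop :=
  [/\ orthonormal D A e,
      forall i, A i -> V (e i)
    & forall f, V f -> (forall i, A i -> ip D f (e i) = 0) ->
        ae_eq_on D f (fun=> 0)].

End L2.

Section multiresolution.
Context {R : realType}.
Implicit Types (phi psi : R -> R) (V : int -> set (R -> R)).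

Definition translates phi (k : int) : R -> R := fun x => phi (x - k%:~R).

Record multiresolution V phi : Prop := {
  mra_closed : forall j, closed_subspace setT (V j);
  mra_nested : forall j, V j `<=` V (j + 1);
  mra_dilation : forall j f, V j f <-> V (j + 1) (fun x => f (2 * x));
  mra_trivial : forall f, (forall j, V j f) -> ae_eq_on setT f (fun=> 0);
  mra_dense : forall f (e : R), L2 setT f -> 0 < e ->
    exists j g, V j g /\ ip setT (f \- g) (f \- g) < e;
  mra_scaling : orthonormal_basis setT (V 0) setT (translates phi) }.

(* The orthogonal complement of V_0 in V_1. *)
Definition detail_space V : set (R -> R) :=
  [set f | V 1 f /\ forall g, V 0 g -> ip setT f g = 0].

Definition scaling_wavelet_pair phi psi : Prop :=
  exists V, multiresolution V phi /\
    orthonormal_basis setT (detail_space V) setT (translates psi).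

Definition twice_continuously_differentiable (f : R -> R) : Prop :=
  [/\ forall x, derivable f x 1,
      forall x, derivable (derive1 f) x 1
    & continuous (derive1 (derive1 f))].

Definition vanishing_moments (N : nat) psi : Prop :=
  forall i, (i < N)%N -> \int[lebesgue_measure]_x (x ^+ i * psi x) = 0.

Definition supported_in (a b : R) (f : R -> R) : Prop :=
  forall x, ~~ (a <= x <= b) -> f x = 0.

End multiresolution.

(* The boundary-corrected wavelets of Cohen, Daubechies and Vial. *)
Section cohen_daubechies_vial.
Context {R : realType}.
Implicit Types (phi psi f : R -> R) (fL fR e raw : nat -> R -> R) (D : set R).

Local Notation halfL := (`[0, +oo[%classic : set R).
Local Notation halfR := (`]-oo, 0]%classic : set R).

(* On [0, +oo[ the translates phi(. - m), m < N, are replaced by the N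
   combinations sum_(m < N) 'C(N - 1 - m, i) phi(. - m), i < N, which are the
   polynomials of degree < N minus their components along the phi(. - m),
   m >= N.  Here n = N - 1 - m; as phi is supported in [1 - K, K], the terms
   with n > N + K - 2 vanish on [0, +oo[. *)
Definition edgeL (K N : nat) phi (i : nat) : R -> R := fun x =>
  \sum_(i <= n < (N + K).-1) 'C(n, i)%:R * phi (x + n%:R - N%:R + 1).

(* The mirror image on ]-oo, 0], with n = N + m: the translates phi(. - m),
   m >= - N, are replaced. *)
Definition edgeR (K N : nat) phi (i : nat) : R -> R := fun x =>
  \sum_(i <= n < (N + K).-1) 'C(n, i)%:R * phi (x - n%:R + N%:R).

(* Any orthonormalisation of [raw 0], ..., [raw (N - 1)] is allowed; this
   includes the Gram-Schmidt procedures giving staggered supports. *)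
Definition orthonormalisation D (N : nat) raw e : Prop :=
  (forall k, (k < N)%N -> exists c : nat -> R,
     forall x, D x -> e k x = \sum_(i < N) c i * raw i x) /\
  orthonormal D [set k | (k < N)%N] e.

(* The projection of the edge scaling function [e k] at level 1 onto the
   orthogonal complement of level 0.  Only the edge functions of level 0
   contribute: for m >= N (resp. m < - N), phi(. - m) is a combination of
   interior scaling functions of level 1, which are orthogonal to
   [e k (2 * .)]. *)
Definition edge_wavelet D (N : nat) e (k : nat) : R -> R := fun x =>
  let ek1 := fun y => Num.sqrt 2 * e k (2 * y) in
  ek1 x - \sum_(l < N) ip D ek1 (e l) * e l x.

(* The function with index [k < 2 ^ j] at level [j], from the interior
   function [f] and the edge functions [fL] at 0 and [fR] at 1. *)
Definition level_function (N : nat) f fL fR (j k : nat) : R -> R := fun x =>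
  2 `^ (j%:R / 2) *
  (if (k < N)%N then fL k (2 ^+ j * x)
   else if (k < 2 ^ j - N)%N then f (2 ^+ j * x - k%:R)
   else fR (2 ^ j - 1 - k)%N (2 ^+ j * (x - 1))).

(* [phi_ k] is phi_(j0,k) and [psi_ j k] is psi_(j,k). *)
Definition wavelet_family (phi_ : nat -> R -> R) (psi_ : nat -> nat -> R -> R)
    (i : nat + nat * nat) : R -> R :=
  match i with inl k => phi_ k | inr (j, k) => psi_ j k end.

Definition wavelet_index (j0 : nat) : set (nat + nat * nat) :=
  [set i | match i with
           | inl k => (k < 2 ^ j0)%N
           | inr (j, k) => (j0 <= j)%N && (k < 2 ^ j)%N
           end].

(* The coarsest level is suitable when the two edges do not interact, i.e.
   2 N <= 2 ^ j0, and the functions form an orthonormal basis. *)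
Definition cdv_basis (K N j0 : nat) phi psi
    (phi_ : nat -> R -> R) (psi_ : nat -> nat -> R -> R) : Prop :=
  exists phiL phiR psiL psiR : nat -> R -> R,
  [/\ orthonormalisation halfL N (edgeL K N phi) phiL /\
      orthonormalisation halfR N (edgeR K N phi) phiR,
      orthonormalisation halfL N (edge_wavelet halfL N phiL) psiL /\
      orthonormalisation halfR N (edge_wavelet halfR N phiR) psiR,
      (forall k, phi_ k = level_function N phi phiL phiR j0 k) /\
      (forall j k, psi_ j k = level_function N psi psiL psiR j k),
      (0 < j0)%N /\ (2 * N <= 2 ^ j0)%N
    & orthonormal_basis `[0, 1] (L2 `[0, 1])
        (wavelet_index j0) (wavelet_family phi_ psi_)].

End cohen_daubechies_vial.

Section self_similar.
Context {R : realType}.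
Variables (j0 : nat) (phi_ : nat -> R -> R) (psi_ : nat -> nat -> R -> R).
Implicit Types (f : R -> R) (s M eps : R).

Definition alpha f (k : nat) : R := ip `[0, 1] f (phi_ k).

Definition beta f (j k : nat) : R := ip `[0, 1] f (psi_ j k).

Definition Cs_norm s f : \bar R :=
  maxe (ereal_sup [set z | exists2 k, (k < 2 ^ j0)%N & z = `|alpha f k|%:E])
       (ereal_sup [set z | exists j k, [/\ (j0 <= j)%N, (k < 2 ^ j)%N
          & z = (2 `^ (j%:R * (s + 2^-1)) * `|beta f j k|)%:E]]).

Definition Cs s : set (R -> R) :=
  [set f | L2 `[0, 1] f /\ (Cs_norm s f < +oo)%E].

Definition Cs_ball s M : set (R -> R) :=
  [set f | L2 `[0, 1] f /\ (Cs_norm s f <= M%:E)%E].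

Definition coarse_part f : R -> R := fun x =>
  \sum_(k < 2 ^ j0) alpha f k * phi_ k x.

Definition detail_part f (l : nat) : R -> R := fun x =>
  \sum_(k < 2 ^ l) beta f l k * psi_ l k x.

(* f_(i,j), for finite j *)
Definition block f (i j : nat) : R -> R := fun x =>
  (if i == j0 then coarse_part f x else 0) +
  \sum_(i <= l < j.+1) detail_part f l x.

(* f_(i,oo); for f in C^s, s > 0, and the continuous representatives of the
   wavelets, the series converges uniformly on [0, 1], so
   this is the continuous representative of its L^2 sum. *)
Definition tail f (i : nat) : R -> R := fun x =>
  (if i == j0 then coarse_part f x else 0) +
  limn (fun n => \sum_(i <= l < n) detail_part f l x).

Definition sup_norm01 f : \bar R :=
  ereal_sup [set z | exists2 x, 0 <= x <= 1 & z = `|f x|%:E].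

Definition self_similar (smax s M eps : R) (rho : nat) : set (R -> R) :=
  [set f | [/\ Cs_ball s M f,
     s < smax -> forall j, (j0 <= j)%N ->
       ((eps * M)%:E <= Cs_norm s (block f j (rho * j)))%E
   & s = smax -> ((eps * M)%:E <= Cs_norm s (block f j0 (rho * j0)))%E]].

Definition decay_condition (s smin b b1 b2 : R) (j1 : nat) f : Prop :=
  [/\ Cs s f, Cs_ball smin b f
    & forall j, (j1 <= j)%N ->
      ((b1 * 2 `^ (- (j%:R * s)))%:E <= sup_norm01 (tail f j.+1))%E /\
      (sup_norm01 (tail f j.+1) <= (b2 * 2 `^ (- (j%:R * s)))%:E)%E].

End self_similar.

(* Main.v *)
(* The wavelets at level [l] are 2 ^ (l / 2) times bounded functions supported
   in intervals of length O(2 ^ (- l)), boundary functions included.  Hence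
   sum_k |psi_(l,k)| = O(2 ^ (l / 2)) and the L^1 norms are O(2 ^ (- l / 2)).
   Both parts rest on these two bounds and on orthonormality alone.
   (a) The upper bound on the tails gives f in C^s(M), as beta_(l,k) is the
   inner product of the tail from level l with psi_(l,k).  If the coefficients
   at levels j, ..., rho j were small compared with M, then the tail from about
   level j would be at most a small multiple of 2 ^ (- j s) plus the tail from
   level rho j, which is O(2 ^ (- rho j s)): this contradicts the lower bound.
   (b) Take coefficients of maximal size at position 0 of the levels j0 2 ^ i
   only, and 0 elsewhere.  Every window [j, rho j] contains such a level, but
   the tail after level l = j0 2 ^ i is O(2 ^ (- 2 l s)). *)

Require Import Defs.
From HB Require Import structures.
From mathcomp Require Import all_boot all_order all_algebra.
From mathcomp Require Import all_classical all_reals all_analysis.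
From mathcomp Require Import lra zify ring.

Set Implicit Arguments.
Unset Strict Implicit.
Unset Printing Implicit Defensive.

Import Order.TTheory GRing.Theory Num.Theory.
Import numFieldNormedType.Exports.
Import measurable_realfun.
Local Open Scope classical_set_scope.
Local Open Scope ring_scope.

(** * Square-integrable functions and the inner product on a measurable set *)

Section L2_algebra.
Context {R : realType}.
Implicit Types (D : set R) (f g : R -> R).
Local Notation mu := (@lebesgue_measure R).

(** Domination by [f ^+ 2 + g ^+ 2]. *)
Lemma L2_mul_integrable D f g : measurable (D : set (measurableTypeR R)) ->
  L2 D f -> L2 D g -> mu.-integrable D (EFin \o (fun x => f x * g x)).
Proof.
move=> mD [mf f2] [mg g2].
have sq (h : R -> R) : measurable_fun D h -> (\int[mu]_(x in D) ((h x) ^+ 2)%:E < +oo)%E ->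
    mu.-integrable D (EFin \o (fun x => h x ^+ 2)).
  move=> mh h2; apply/integrableP; split.
    by apply/measurable_EFinP; exact: measurable_funX.
  congr (_ < +oo)%E: h2; apply: eq_integral => x _ /=.
  by rewrite ger0_norm// sqr_ge0.
apply: (@le_integrable _ _ _ mu D mD _ (EFin \o (fun x => f x ^+ 2 + g x ^+ 2))).
- by apply/measurable_EFinP; exact: measurable_funM.
- move=> x _ /=; rewrite lee_fin (ger0_norm (addr_ge0 (sqr_ge0 _) (sqr_ge0 _))).
  rewrite ler_norml; apply/andP; split; nra.
- exact: (integrableD mD (sq f mf f2) (sq g mg g2)).
Qed.

Lemma L2_lin D a f g : measurable (D : set (measurableTypeR R)) ->
  L2 D f -> L2 D g -> L2 D (fun x => a * f x + g x).
Proof.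
move=> mD Lf Lg; have [mf _] := Lf; have [mg _] := Lg.
have mh : measurable_fun D (fun x => a * f x + g x).
  by apply: measurable_funD => //; exact: measurable_funM.
split => //.
have -> : (fun x => ((a * f x + g x) ^+ 2)%:E) =
    EFin \o (fun x => a ^+ 2 * (f x * f x) + (a *+ 2 * (f x * g x) + g x * g x)).
  by apply/funext => x /=; congr EFin; ring.
have i1 := L2_mul_integrable mD Lf Lf.
have i2 := L2_mul_integrable mD Lf Lg.
have i3 := L2_mul_integrable mD Lg Lg.
have := integrableD mD (integrableZl mD (a ^+ 2) i1)
   (integrableD mD (integrableZl mD (a *+ 2) i2) i3).
move=> /integrable_lty; apply.
by [].
Qed.

Lemma L2_cst0 D : L2 D (fun=> 0 : R).
Proof.
split; first exact: measurable_cst.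
under eq_integral do rewrite expr0n/=.
by rewrite integral0.
Qed.

Lemma ip_lin D a f g h : measurable (D : set (measurableTypeR R)) -> L2 D f -> L2 D g -> L2 D h ->
  ip D (fun x => a * f x + g x) h = a * ip D f h + ip D g h.
Proof.
move=> mD Lf Lg Lh; rewrite /ip.
have i1 := L2_mul_integrable mD Lf Lh.
have i2 := L2_mul_integrable mD Lg Lh.
rewrite -(RintegralZl _ mD i1) -RintegralD//; last exact: (integrableZl mD a i1).
by apply: eq_Rintegral => x _; rewrite mulrDl mulrA.
Qed.

Lemma ip0f D h : ip D (fun=> 0) h = 0 :> R.
Proof.
rewrite /ip /Rintegral.
by under eq_integral do rewrite mul0r; rewrite integral0.
Qed.

Lemma L2_ip_sum D (I : eqType) (r : seq I) (c : I -> R) (e : I -> R -> R) h :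
  measurable (D : set (measurableTypeR R)) -> (forall i, i \in r -> L2 D (e i)) -> L2 D h ->
  L2 D (fun x => \sum_(i <- r) c i * e i x) /\
  ip D (fun x => \sum_(i <- r) c i * e i x) h = \sum_(i <- r) c i * ip D (e i) h.
Proof.
move=> mD; elim: r => [|i r IH] Le Lh.
  rewrite big_nil (_ : (fun x : R => \sum_(i <- [::]) c i * e i x) = (fun=> 0)).
    by split; [exact: L2_cst0|exact: ip0f].
  by apply/funext => x; rewrite big_nil.
have [L1 E1] := IH (fun j jr => Le j (mem_behead (s := i :: r) jr)) Lh.
have Li := Le i (mem_head _ _).
have -> : (fun x => \sum_(j <- i :: r) c j * e j x) =
   (fun x => c i * e i x + \sum_(j <- r) c j * e j x).
  by apply/funext => x; rewrite big_cons.
by split; [exact: L2_lin|rewrite big_cons ip_lin// E1].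
Qed.

(** With a basis function as [g], this turns a sup bound on a function into a bound on its
    coefficients. *)
Lemma ip_le D f g (B : R) : measurable (D : set (measurableTypeR R)) -> L2 D f -> L2 D g ->
  mu.-integrable D (EFin \o g) -> (forall x, D x -> `|f x| <= B) ->
  `|ip D f g| <= B * \int[mu]_(x in D) `|g x|.
Proof.
move=> mD Lf Lg ig fB.
have i1 := L2_mul_integrable mD Lf Lg.
apply: le_trans (le_normr_Rintegral mD i1) _.
have iag : mu.-integrable D (EFin \o (fun x => `|g x|)) by exact: (integrable_abse ig).
have iafg : mu.-integrable D (EFin \o (fun x => `|f x * g x|)).
  exact: (integrable_abse i1).
rewrite -(RintegralZl _ mD iag); apply: le_Rintegral => //.
  exact: (integrableZl mD B iag).
by move=> x Dx; rewrite normrM ler_wpM2r// fB.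
Qed.

End L2_algebra.

(** * Wavelet series with a given array of coefficients *)

Section wavelet_series.
Context {R : realType}.
Context (j0 : nat) (phi_ : nat -> R -> R) (psi_ : nat -> nat -> R -> R).
Implicit Types (c : nat -> nat -> R) (A C q x : R).
Local Notation mu := (@lebesgue_measure R).
Local Notation I01 := (`[0, 1]%classic : set R).

(** The coefficients are an arbitrary array: [c := beta psi_ f] gives the tails of [f], while part
    (b) starts from a prescribed [c]. *)
Definition wavelet_sum c (i n : nat) : R -> R := fun x =>
  \sum_(i <= l < n) \sum_(k < 2 ^ l) c l k * psi_ l k x.

Definition wavelet_lim c (i : nat) : R -> R := fun x =>
  limn (fun n => wavelet_sum c i n x).

Definition sup_bounded C : Prop := forall l x, 0 <= x <= 1 ->
  \sum_(k < 2 ^ l) `|psi_ l k x| <= C * 2 `^ (l%:R / 2).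

(** Integrability is included because an infinite integral would be read as the real number 0, which
    would make the bound empty. *)
Definition L1_bounded C : Prop := forall l k, (j0 <= l)%N -> (k < 2 ^ l)%N ->
  mu.-integrable I01 (EFin \o psi_ l k) /\
  \int[mu]_(x in I01) `|psi_ l k x| <= C * 2 `^ (- (l%:R / 2)).

(* The coefficient bound of the ball C^s(A), with [q = 2 ^ (- s)]. *)
Definition coef_bounded c A q (i n : nat) : Prop := forall l k,
  (i <= l < n)%N -> (k < 2 ^ l)%N ->
  `|c l k| <= A * (q ^+ l * 2 `^ (- (l%:R / 2))).

Lemma powR2_gt0 (a : R) : 0 < 2 `^ a.
Proof. by rewrite powR_gt0. Qed.

Lemma geometric_sum_le q i n : 0 <= q < 1 ->
  \sum_(i <= l < n) q ^+ l <= q ^+ i / (1 - q).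
Proof.
move=> /andP[q0 q1]; have q1' : 0 < 1 - q by rewrite subr_gt0.
have [ni|/ltnW ilen] := leqP n i.
  by rewrite big_geq// divr_ge0// ?exprn_ge0// ltW.
suff -> : \sum_(i <= l < n) q ^+ l = (q ^+ i - q ^+ n) / (1 - q).
  by rewrite ler_pM2r ?invr_gt0// lerBlDr lerDl exprn_ge0.
rewrite -(subnKC ilen); elim: (n - i)%N => [|m IH].
  by rewrite addn0 big_geq// subrr mul0r.
rewrite addnS big_nat_recr ?leq_addr//= IH exprS; field.
by rewrite gt_eqF.
Qed.

(** The growth 2 ^ (l / 2) of the wavelets cancels against the factor 2 ^ (- l / 2) of the
    coefficients, which leaves the geometric factor [q ^+ l]. *)
Lemma level_sum_le c A C q i n l x : sup_bounded C -> coef_bounded c A q i n ->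
  0 <= x <= 1 -> (i <= l < n)%N ->
  `|\sum_(k < 2 ^ l) c l k * psi_ l k x| <= A * C * q ^+ l.
Proof.
move=> HC cA x01 iln; apply: le_trans (ler_norm_sum _ _ _) _.
apply: (@le_trans _ _ (\sum_(k < 2 ^ l)
    A * (q ^+ l * 2 `^ (- (l%:R / 2))) * `|psi_ l k x|)).
  by apply: ler_sum => k _; rewrite normrM ler_wpM2r// cA.
rewrite -mulr_sumr.
(* The sign comes from the bound on the coefficient at position 0. *)
have A0 : 0 <= A * (q ^+ l * 2 `^ (- (l%:R / 2))).
  by apply: le_trans (cA l 0%N iln _); rewrite ?expn_gt0.
apply: le_trans (ler_wpM2l A0 (HC l x x01)) _.
rewrite powRN le_eqVlt; apply/orP; left; apply/eqP; field.
by rewrite gt_eqF ?powR2_gt0.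
Qed.

Lemma wavelet_sum_le c A C q i n x : 0 <= A -> 0 <= C -> 0 <= q < 1 ->
  sup_bounded C -> coef_bounded c A q i n -> 0 <= x <= 1 ->
  `|wavelet_sum c i n x| <= A * C * (q ^+ i / (1 - q)).
Proof.
move=> A0 C0 q01 HC cA x01; apply: le_trans (ler_norm_sum _ _ _) _.
rewrite big_nat_cond.
apply: (@le_trans _ _ (\sum_(i <= l < n | (i <= l < n)%N && true)
    A * C * q ^+ l)).
  by apply: ler_sum => l; rewrite andbT => /level_sum_le ->.
rewrite -big_nat_cond -mulr_sumr ler_wpM2l ?mulr_ge0//.
exact: geometric_sum_le.
Qed.

Lemma coef_bounded_sub c A q i n i' n' : (i <= i')%N -> (n' <= n)%N ->
  coef_bounded c A q i n -> coef_bounded c A q i' n'.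
Proof.
by move=> ii nn cA l k /andP[il ln]; apply: cA;
  rewrite (leq_trans ii il) (leq_trans ln nn).
Qed.

Lemma wavelet_sum_cvg c A C q i x : 0 <= A -> 0 <= C -> 0 <= q < 1 ->
  sup_bounded C -> (forall n, coef_bounded c A q i n) -> 0 <= x <= 1 ->
  cvgn (fun n => wavelet_sum c i n x).
Proof.
move=> A0 C0 q01 HC cA x01.
(* Zero terms below level [i] give a series starting at 0, which a geometric series dominates
   termwise. *)
pose d l := if (i <= l)%N then \sum_(k < 2 ^ l) c l k * psi_ l k x else 0.
have -> : (fun n => wavelet_sum c i n x) =
    [sequence \sum_(i <= l < n) d l]_n.
  apply/funext => n; rewrite /wavelet_sum /=; apply: eq_big_nat => l /andP[il _].
  by rewrite /d il.
rewrite is_cvg_series_restrict; apply: normed_cvg.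
apply: (@series_le_cvg _ _ (geometric (A * C) q)).
- by move=> n; exact: normr_ge0.
- by move=> n; rewrite /geometric /= !mulr_ge0// exprn_ge0//; case/andP: q01.
- move=> n; rewrite /d /geometric /=; case: ifPn => [il|_].
    by apply: (level_sum_le (n := n.+1) HC (cA _) x01); rewrite il ltnSn.
  by rewrite normr0 !mulr_ge0// exprn_ge0//; case/andP: q01.
- apply: is_cvg_geometric_series.
  by case/andP: q01 => q0 q1; rewrite ger0_norm.
Qed.

(** Past [m], the partial sums from [i] and from [m] differ by a constant. The coefficient bound
    concerns only the levels from [m] on, so that the levels before [m] can be estimated by another
    constant. *)
Lemma wavelet_lim_split c A C q i m x : 0 <= A -> 0 <= C -> 0 <= q < 1 ->
  sup_bounded C -> (forall n, coef_bounded c A q m n) -> 0 <= x <= 1 ->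
  (i <= m)%N -> wavelet_lim c i x = wavelet_sum c i m x + wavelet_lim c m x.
Proof.
move=> A0 C0 q01 HC cA x01 im; apply/cvg_lim => //.
have cm := wavelet_sum_cvg A0 C0 q01 HC cA x01.
have : (fun n => wavelet_sum c i m x + wavelet_sum c m n x) @ \oo -->
    wavelet_sum c i m x + wavelet_lim c m x.
  by apply: cvgD; [exact: cvg_cst|exact: cm].
apply: cvg_trans; apply: near_eq_cvg; near=> n.
rewrite /wavelet_sum [RHS](@big_cat_nat _ _ _ m)//.
by near: n; exists m.
Unshelve. all: by end_near. Qed.

Lemma wavelet_lim_le c A C q i x : 0 <= A -> 0 <= C -> 0 <= q < 1 ->
  sup_bounded C -> (forall n, coef_bounded c A q i n) -> 0 <= x <= 1 ->
  `|wavelet_lim c i x| <= A * C * (q ^+ i / (1 - q)).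
Proof.
move=> A0 C0 q01 HC cA x01.
have cm := wavelet_sum_cvg A0 C0 q01 HC cA x01.
have B n := wavelet_sum_le A0 C0 q01 HC (cA n) x01.
rewrite ler_norml; apply/andP; split.
  by apply: limr_ge => //; near=> n; have := B n; rewrite ler_norml => /andP[].
by apply: limr_le => //; near=> n; have := B n; rewrite ler_norml => /andP[].
Unshelve. all: by end_near. Qed.

Context (ortho : Defs.orthonormal I01 (wavelet_index j0) (wavelet_family phi_ psi_)).

Lemma psi_L2 l k : (j0 <= l)%N -> (k < 2 ^ l)%N -> L2 I01 (psi_ l k).
Proof.
by move=> jl kl; case: ortho => H _ _; apply: (H (inr (l, k))); rewrite /= jl kl.
Qed.

Lemma phi_L2 k : (k < 2 ^ j0)%N -> L2 I01 (phi_ k).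
Proof. by case: ortho => H _ _; exact: (H (inl k)). Qed.

Lemma ip_psi_psi l k l' k' : (j0 <= l)%N -> (k < 2 ^ l)%N ->
  (j0 <= l')%N -> (k' < 2 ^ l')%N ->
  ip I01 (psi_ l k) (psi_ l' k') = ((l == l') && (k == k'))%:R.
Proof.
move=> jl kl jl' kl'; case: ortho => _ H1 H0.
case: eqVneq => [ell|ll]; last first.
  apply: (H0 (inr (l, k)) (inr (l', k'))); rewrite /= ?jl ?kl ?jl' ?kl'//.
  by case=> e _; rewrite e eqxx in ll.
subst l'; case: eqVneq => [ekk|kk].
  by subst k'; apply: (H1 (inr (l, k))); rewrite /= jl kl.
apply: (H0 (inr (l, k)) (inr (l, k'))); rewrite /= ?jl ?kl ?jl' ?kl'//.
by case=> e; rewrite e eqxx in kk.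
Qed.

Lemma ip_psi_phi l k k' : (j0 <= l)%N -> (k < 2 ^ l)%N -> (k' < 2 ^ j0)%N ->
  ip I01 (psi_ l k) (phi_ k') = 0.
Proof.
move=> jl kl kj; case: ortho => _ _ H0.
by apply: (H0 (inr (l, k)) (inl k')); rewrite /= ?jl ?kl.
Qed.

Lemma ip_phi_psi l k k' : (j0 <= l)%N -> (k < 2 ^ l)%N -> (k' < 2 ^ j0)%N ->
  ip I01 (phi_ k') (psi_ l k) = 0.
Proof.
move=> jl kl kj; case: ortho => _ _ H0.
by apply: (H0 (inl k') (inr (l, k))); rewrite /= ?jl ?kl.
Qed.

Let mI01 : measurable (I01 : set (measurableTypeR R)).
Proof. exact: measurable_itv. Qed.

Lemma level_sum_L2_ip c l g : (j0 <= l)%N -> L2 I01 g ->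
  L2 I01 (fun x => \sum_(k < 2 ^ l) c l k * psi_ l k x) /\
  ip I01 (fun x => \sum_(k < 2 ^ l) c l k * psi_ l k x) g =
  \sum_(k < 2 ^ l) c l k * ip I01 (psi_ l k) g.
Proof. by move=> jl Lg; apply: L2_ip_sum => // k _; exact: psi_L2. Qed.

Lemma wavelet_sum_L2_ip c i n g : (j0 <= i)%N -> L2 I01 g ->
  L2 I01 (wavelet_sum c i n) /\
  ip I01 (wavelet_sum c i n) g =
  \sum_(i <= l < n) \sum_(k < 2 ^ l) c l k * ip I01 (psi_ l k) g.
Proof.
move=> ji Lg.
have H l : l \in index_iota i n ->
    L2 I01 (fun x => \sum_(k < 2 ^ l) c l k * psi_ l k x).
  rewrite mem_index_iota => /andP[il _].
  by have [] := level_sum_L2_ip c (leq_trans ji il) Lg.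
have := L2_ip_sum (fun=> 1) mI01 H Lg.
have -> : (fun x => \sum_(l <- index_iota i n) 1 *
    (\sum_(k < 2 ^ l) c l k * psi_ l k x)) = wavelet_sum c i n.
  by apply/funext => x; apply: eq_bigr => l _; rewrite mul1r.
move=> [LW ->]; split => //; apply: eq_big_nat => l /andP[il _].
by rewrite mul1r; have [] := level_sum_L2_ip c (leq_trans ji il) Lg.
Qed.

(** By orthonormality only the term at [(l, k)] can survive. *)
Lemma ip_wavelet_sum_psi c i n l k : (j0 <= i)%N -> (j0 <= l)%N ->
  (k < 2 ^ l)%N ->
  ip I01 (wavelet_sum c i n) (psi_ l k) = if (i <= l < n)%N then c l k else 0.
Proof.
move=> ji jl kl; have [_ ->] := wavelet_sum_L2_ip c n ji (psi_L2 jl kl).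
have E l' : (i <= l' < n)%N ->
    \sum_(k' < 2 ^ l') c l' k' * ip I01 (psi_ l' k') (psi_ l k) =
    if l' == l then c l k else 0.
  move=> /andP[il' _]; case: eqVneq => [->|ll'].
    rewrite (bigD1 (Ordinal kl))//= ip_psi_psi// !eqxx mulr1 big1 ?addr0// => k' kk'.
    by rewrite ip_psi_psi// (_ : (_ == k) = false) ?andbF ?mulr0//; exact: negPf.
  rewrite big1// => k' _; rewrite ip_psi_psi ?(negPf ll') ?mulr0//.
  exact: leq_trans il'.
rewrite (eq_big_nat _ _ E) -big_mkcond/=; case: ifPn => [iln|].
  rewrite (big_rem l) ?mem_index_iota//= eqxx big_seq_cond big_pred0 ?addr0// => l'.
  by apply/negP => /andP[+ /eqP ell]; subst l'; rewrite mem_rem_uniq ?iota_uniq// inE eqxx.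
move=> niln; rewrite big_seq_cond big_pred0// => l'.
apply/negP => /andP[+ /eqP ell]; subst l'; rewrite mem_index_iota.
by rewrite (negPf niln).
Qed.

Lemma ip_wavelet_sum_phi c i n k : (j0 <= i)%N -> (k < 2 ^ j0)%N ->
  ip I01 (wavelet_sum c i n) (phi_ k) = 0.
Proof.
move=> ji kj; have [_ ->] := wavelet_sum_L2_ip c n ji (phi_L2 kj).
rewrite big_nat big1// => l /andP[il _]; rewrite big1// => k' _.
by rewrite ip_psi_phi ?mulr0//; exact: leq_trans il.
Qed.

End wavelet_series.

(** * Sup and L^1 bounds on the wavelets, boundary functions included *)

Section edge_bounds.
Context {R : realType}.
Implicit Types (D : set R) (f g : R -> R).
Local Notation mu := (@lebesgue_measure R).
Local Notation I01 := (`[0, 1]%classic : set R).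

(** One predicate covers the interior functions, with [D] the whole line, and the edge functions,
    with [D] a half-line outside which their values are irrelevant. *)
Definition bounded_within D (L B : R) f : Prop :=
  forall x, D x -> `|f x| <= B /\ (L < `|x| -> f x = 0).

Lemma bounded_within_ext D L B f g : (forall x, D x -> f x = g x) ->
  bounded_within D L B g -> bounded_within D L B f.
Proof. by move=> fg H x Dx; rewrite fg//; exact: H. Qed.

Lemma bounded_within_le D L B B' f : B <= B' ->
  bounded_within D L B f -> bounded_within D L B' f.
Proof.
by move=> BB' H x /H[fB f0]; split => //; exact: le_trans BB'.
Qed.

Lemma bounded_within_sum D L (I : eqType) (r : seq I) (c : I -> R) (F : I -> R -> R) :
  (forall i, i \in r -> exists B, bounded_within D L B (F i)) ->
  exists B, bounded_within D L B (fun x => \sum_(i <- r) c i * F i x).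
Proof.
elim: r => [|i r IH] H.
  by exists 0 => x _; rewrite big_nil normr0.
have [B HB] := IH (fun j jr => H j (mem_behead (s := i :: r) jr)).
have [B' HB'] := H i (mem_head _ _).
exists (`|c i| * B' + B) => x Dx; rewrite big_cons.
have [f1 f2] := HB x Dx; have [g1 g2] := HB' x Dx; split.
  by rewrite (le_trans (ler_normD _ _))// lerD// normrM ler_wpM2l.
by move=> xL; rewrite f2// g2// mulr0 addr0.
Qed.

Lemma bounded_within_uniform D L N (e : nat -> R -> R) :
  (forall k, (k < N)%N -> exists B, bounded_within D L B (e k)) ->
  exists B, forall k, (k < N)%N -> bounded_within D L B (e k).
Proof.
elim: N => [|N IH] H; first by exists 0.
have [B HB] := IH (fun k kN => H k (ltnW kN)).
have [B' HB'] := H N (ltnSn N).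
exists (Num.max B B') => k; rewrite ltnS leq_eqVlt => /orP[/eqP ->|kN].
  by apply: bounded_within_le HB'; rewrite le_max lexx orbT.
by apply: bounded_within_le (HB k kN); rewrite le_max lexx.
Qed.

Lemma supported_bounded_within (a b L : R) f : continuous f ->
  supported_in a b f -> - L <= a -> b <= L ->
  exists B, bounded_within setT L B f.
Proof.
move=> cf sf La bL.
have fL x : L < `|x| -> f x = 0.
  move=> Lx; apply: sf; apply/negP => /andP[ax xb]; move: Lx.
  rewrite ltNge => /negP; apply; rewrite ler_norml; apply/andP; split; lra.
(* For negative [L] the function vanishes identically; otherwise its modulus attains a maximum on
   [- L, L]. *)
have [L0|L0] := leP 0 L; last first.
  exists 0 => x _; have fx : f x = 0 by apply: fL; apply: lt_le_trans L0 _.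
  by rewrite fx normr0.
have : {within `[- L, L], continuous (fun x => `|f x|)}.
  apply: continuous_subspaceT => x; apply: continuous_comp; first exact: cf.
  exact: norm_continuous.
move=> /(EVT_max (_ : - L <= L))[|c cL cM]; first by lra.
exists `|f c| => x _; split; last exact: fL.
have [xL|/fL ->] := leP `|x| L; last by rewrite normr0.
by apply: cM; rewrite in_itv /= -ler_norml.
Qed.

Lemma orthonormalisation_bounded D L N raw e :
  orthonormalisation D N raw e ->
  (forall i, (i < N)%N -> exists B, bounded_within D L B (raw i)) ->
  forall k, (k < N)%N -> exists B, bounded_within D L B (e k).
Proof.
move=> [span _] H k kN; have [c ec] := span k kN.
have [B HB] := @bounded_within_sum D L _ (index_enum 'I_N) (fun i => c i)
  (fun i => raw i) (fun i _ => H i (ltn_ord i)).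
exists B; apply: bounded_within_ext HB => x Dx; exact: ec.
Qed.

(** For [x > K + N] the argument of [phi] is at least [x - N + 1], hence beyond the support for
    every [n]. *)
Lemma edgeL_bounded K N phi B i : (forall x, `|phi x| <= B) ->
  supported_in (1 - K%:R) K%:R phi ->
  exists B', bounded_within `[0, +oo[ (K + N)%:R B' (edgeL K N phi i).
Proof.
move=> phiB sphi; apply: bounded_within_sum => n _; exists B => x /=.
rewrite in_itv/= andbT => x0; split; first exact: phiB.
rewrite ger0_norm// natrD => xL; apply: sphi; apply/negP => /andP[_].
have : 0 <= n%:R :> R by [].
lra.
Qed.

Lemma edgeR_bounded K N phi B i : (forall x, `|phi x| <= B) ->
  supported_in (1 - K%:R) K%:R phi ->
  exists B', bounded_within `]-oo, 0] (K + N)%:R B' (edgeR K N phi i).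
Proof.
move=> phiB sphi; apply: bounded_within_sum => n _; exists B => x /=.
rewrite in_itv/= => x0; split; first exact: phiB.
rewrite ler0_norm// natrD => xL; apply: sphi; apply/negP => /andP[+ _].
have : 0 <= n%:R :> R by [].
lra.
Qed.

(** Doubling the argument halves the support, and [D] is stable under doubling, so the same [L]
    serves the edge wavelets. *)
Lemma edge_wavelet_bounded D L N e k : 0 <= L ->
  (forall x, D x -> D (2 * x)) ->
  (forall l, (l < N)%N -> exists B, bounded_within D L B (e l)) -> (k < N)%N ->
  exists B, bounded_within D L B (edge_wavelet D N e k).
Proof.
move=> L0 D2 He kN; have [Bk HBk] := He k kN.
rewrite /edge_wavelet.
have [B HB] := @bounded_within_sum D L _ (index_enum 'I_N)
  (fun l => ip D (fun y => Num.sqrt 2 * e k (2 * y)) (e l)) (fun l => e l)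
  (fun l _ => He l (ltn_ord l)).
exists (Num.sqrt 2 * Bk + B) => x Dx.
have [e1 e2] := HBk _ (D2 x Dx); have [s1 s2] := HB x Dx; split.
  rewrite (le_trans (ler_normB _ _))// lerD// normrM ger0_norm ?sqrtr_ge0//.
  by rewrite ler_wpM2l ?sqrtr_ge0.
move=> xL; rewrite s2// e2 ?mulr0 ?subrr//.
by rewrite normrM ger0_norm//; have := normr_ge0 x; lra.
Qed.

(** Used to count the wavelets of one level that can be non-zero at a given point. *)
Lemma count_interval (n a b : nat) : (\sum_(k < n) (a <= k < a + b) <= b)%N.
Proof.
(* The bound [n - a] carries the induction: it leaves room for the index [n] when [n] itself lies in
   the interval. *)
suff : (\sum_(k < n) (a <= k < a + b) <= minn b (n - a))%N.
  by move=> H; apply: leq_trans H (geq_minl _ _).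
elim: n => [|n IH]; first by rewrite big_ord0.
rewrite big_ord_recr/=; move: IH; move: (\sum_(i < n) _)%N => S.
rewrite !leq_min => /andP[Sb Sn].
by case: (leqP a n) => an; case: (ltnP n (a + b)) => nb /=; lia.
Qed.

(** The constant 1 is square-integrable on the unit interval. *)
Lemma L2_I01_integrable g : L2 I01 g -> mu.-integrable I01 (EFin \o g).
Proof.
move=> Lg.
have mI : measurable (I01 : set (measurableTypeR R)) by exact: measurable_itv.
have L1 : L2 I01 (fun=> 1 : R).
  split; first exact: measurable_cst.
  under eq_integral do rewrite expr1n.
  rewrite integral_cst// mul1e; have : (mu I01 < +oo)%E; last by [].
  by rewrite lebesgue_measure_itv/= lte_fin ltr01 -EFinB ltry.
have := L2_mul_integrable mI L1 Lg.
by under [X in EFin \o X]eq_fun do rewrite mul1r.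
Qed.

(** Domination by [B] times the indicator of the interval [J] of length [2 * r]. *)
Lemma L1_le_supported g (B c r : R) : 0 <= B -> 0 <= r -> L2 I01 g ->
  (forall x, I01 x -> `|g x| <= B) ->
  (forall x, I01 x -> r < `|x - c| -> g x = 0) ->
  \int[mu]_(x in I01) `|g x| <= B * (2 * r).
Proof.
move=> B0 r0 Lg gB g0.
have mI : measurable (I01 : set (measurableTypeR R)) by exact: measurable_itv.
pose J : set (measurableTypeR R) := `[c - r, c + r]%classic.
have mJ : measurable J by exact: measurable_itv.
have ig := L2_I01_integrable Lg.
have muJ : mu J = (2 * r)%:E.
  rewrite lebesgue_measure_itv/= lte_fin -EFinB.
  (* The measure formula separates the degenerate interval, here the case [r = 0]. *)
  case: ifPn => [_|]; first by congr EFin; ring.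
  by rewrite -leNgt => ?; congr EFin; lra.
have muJI : (mu (J `&` I01) <= (2 * r)%:E)%E.
  by rewrite -muJ; apply: le_measure; rewrite ?inE//; exact: measurableI.
have muJf : mu (J `&` I01) \is a fin_num.
  by rewrite ge0_fin_numE// (le_lt_trans muJI)// ltry.
have iJ : mu.-integrable I01 (EFin \o (\1_J : R -> R)).
  apply/integrableP; split.
    by apply/measurable_EFinP; exact: measurable_indic.
  under eq_integral => x _ do rewrite /= ger0_norm//.
  by rewrite integral_indic// (le_lt_trans muJI)// ltry.
apply: (@le_trans _ _ (\int[mu]_(x in I01) (B * \1_J x))).
  apply: le_Rintegral => //.
  - exact: (integrable_abse ig).
  - exact: (integrableZl mI B iJ).
  - move=> x Ix; rewrite indicE; have [xJ|xJ] := boolP (x \in J).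
      by rewrite mulr1 gB.
    rewrite mulr0 g0 ?normr0// ltNge; apply: contra xJ => xc.
    by rewrite inE /J /= in_itv/=; move: xc; rewrite ler_distl.
have -> : \int[mu]_(x in I01) (B * \1_J x) = B * \int[mu]_(x in I01) \1_J x.
  exact: (RintegralZl B mI iJ).
have -> : \int[mu]_(x in I01) \1_J x = fine (mu (J `&` I01)).
  by rewrite /Rintegral integral_indic.
by rewrite ler_wpM2l// -lee_fin fineK.
Qed.

(** The three indicators stand for the left edge, the right edge and the interior translates that
    can be non-zero at [x]. Overlaps, and truncation in [m - L], only weaken the bound; in this form
    its sum over [k] is a mere count. *)
Lemma level_function_le (L N m : nat) B f fL fR j k x : 0 <= B ->
  bounded_within setT L%:R B f ->
  (forall k, (k < N)%N -> bounded_within `[0, +oo[ L%:R B (fL k)) ->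
  (forall k, (k < N)%N -> bounded_within `]-oo, 0] L%:R B (fR k)) ->
  (k < 2 ^ j)%N -> 0 <= x <= 1 ->
  m = Num.truncn (2 ^+ j * x) ->
  `|level_function N f fL fR j k x| <= B * 2 `^ (j%:R / 2) *
    ((0 <= k < 0 + N) + (2 ^ j - N <= k < 2 ^ j - N + N) +
     (m - L <= k < m - L + (2 * L).+1))%:R.
Proof.
move=> B0 Hf HL HR kj /andP[x0 x1] Em.
have p0 : 0 <= 2 ^+ j * x by rewrite mulr_ge0// exprn_ge0.
rewrite /level_function normrM ger0_norm ?powR_ge0// mulrC -[leRHS]mulrA.
rewrite [leRHS]mulrCA [leLHS]mulrC ler_wpM2l ?powR_ge0//.
case: ifPn => [kN|]; last rewrite -leqNgt => Nk.
  rewrite leq0n /=.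
  apply: (@le_trans _ _ B); last by rewrite ler_peMr// ler1n.
  by apply: (HL k kN _ _).1; rewrite /= in_itv/= p0.
case: ifPn => [kN|]; last rewrite -leqNgt => Nk'.
  set t := 2 ^+ j * x - k%:R.
  have [tB t0] := Hf t I.
  have [tL|/t0 ->] := leP `|t| L%:R; last by rewrite normr0 mulr_ge0.
  apply: le_trans tB _; rewrite ler_peMr// ler1n.
  have /andP[m1 m2] := truncn_itv p0; rewrite -Em in m1 m2.
  move: tL; rewrite ler_norml /t => /andP[t1 t2].
  have a1 : (k < m + 1 + L)%N.
    by rewrite -(ltr_nat R) !natrD; move: m2; rewrite -natr1; lra.
  have a2 : (m <= k + L)%N by rewrite -(ler_nat R) natrD; lra.
  have -> : (m - L <= k < m - L + (2 * L).+1)%N by apply/andP; split; lia.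
  lia.
have -> : (2 ^ j - N <= k < 2 ^ j - N + N)%N by rewrite Nk'/=; lia.
apply: (@le_trans _ _ B); last by rewrite ler_peMr// ler1n; lia.
apply: (HR _ _ _ _).1; first lia.
by rewrite /= in_itv/= mulr_ge0_le0 ?exprn_ge0// subr_le0.
Qed.

(** The centre is 0 for the left edge functions, 1 for the right ones and k / 2 ^ j for the interior
    ones. *)
Lemma level_function_supp (L N : nat) B f fL fR j k :
  bounded_within setT L%:R B f ->
  (forall k, (k < N)%N -> bounded_within `[0, +oo[ L%:R B (fL k)) ->
  (forall k, (k < N)%N -> bounded_within `]-oo, 0] L%:R B (fR k)) ->
  (k < 2 ^ j)%N -> exists c, forall x, 0 <= x <= 1 ->
  `|level_function N f fL fR j k x| <= B * 2 `^ (j%:R / 2) /\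
  (L%:R / 2 ^+ j < `|x - c| -> level_function N f fL fR j k x = 0).
Proof.
move=> Hf HL HR kj.
have p0 : 0 < 2 ^+ j :> R by rewrite exprn_gt0.
(* Factoring out the normalisation reduces each case to [bounded_within] at the rescaled point 2 ^ j
   (x - c). *)
suff : exists c, forall x, 0 <= x <= 1 -> exists v : R,
    [/\ level_function N f fL fR j k x = 2 `^ (j%:R / 2) * v, `|v| <= B &
     L%:R < `|2 ^+ j * (x - c)| -> v = 0].
  move=> [c H]; exists c => x /H[v [-> vB v0]]; split.
    by rewrite normrM ger0_norm ?powR_ge0// mulrC ler_wpM2r ?powR_ge0.
  move=> xc; rewrite v0 ?mulr0// normrM ger0_norm ?ltW// mulrC.
  by rewrite -ltr_pdivrMr.
rewrite /level_function; case: (ltnP k N) => [kN|Nk].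
  exists 0 => x /andP[x0 x1]; eexists; split; first by [].
    by apply: (HL k kN _ _).1; rewrite /= in_itv/= mulr_ge0// ltW.
  by rewrite subr0; apply: (HL k kN _ _).2; rewrite /= in_itv/= mulr_ge0// ltW.
case: (ltnP k (2 ^ j - N)) => [kN|Nk'].
  exists (k%:R / 2 ^+ j) => x _; eexists; split; first by [].
    by apply: (Hf _ _).1.
  rewrite mulrBr [X in _ - X]mulrC divfK ?gt_eqF//.
  by apply: (Hf _ _).2.
have kR : (2 ^ j - 1 - k < N)%N by lia.
exists 1 => x /andP[x0 x1]; eexists; split; first by [].
  by apply: (HR _ kR _ _).1; rewrite /= in_itv/= mulr_ge0_le0 ?(ltW p0)// subr_le0.
by apply: (HR _ kR _ _).2; rewrite /= in_itv/= mulr_ge0_le0 ?(ltW p0)// subr_le0.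
Qed.

Lemma powR2_half j : 2 `^ (j%:R / 2) * 2 `^ (j%:R / 2) = 2 ^+ j :> R.
Proof.
rewrite -powRD; last by rewrite pnatr_eq0 implybT.
by rewrite -powR_mulrn//; congr (_ `^ _); field.
Qed.

(** On their half-lines the edge functions are finite combinations of translates and dilates of
    [phi], hence bounded and supported within [K + N] of the endpoint. Rescaling to level [l] then
    gives both bounds. *)
Lemma cdv_bounds K N j0 phi psi phi_ psi_ :
  cdv_basis K N j0 phi psi phi_ psi_ -> continuous phi -> continuous psi ->
  supported_in (1 - K%:R) K%:R phi -> supported_in (1 - K%:R) K%:R psi ->
  exists2 C : R, 0 < C & sup_bounded psi_ C /\ L1_bounded j0 psi_ C.
Proof.
move=> [fL [fR [gL [gR [[oL oR] [oL' oR'] [_ Epsi] _ [[basisL2 _ _] _ _]]]]]].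
move=> cphi cpsi sphi spsi.
have L0 : 0 <= (K + N)%:R :> R by [].
have KL : K%:R <= (K + N)%:R :> R by rewrite ler_nat leq_addr.
have LK : - (K + N)%:R <= 1 - K%:R :> R by lra.
have [Bphi Hphi] := supported_bounded_within cphi sphi LK KL.
have phiB x : `|phi x| <= Bphi by have [] := Hphi x I.
have [Bpsi Hpsi] := supported_bounded_within cpsi spsi LK KL.
have eL := orthonormalisation_bounded oL (fun i _ => edgeL_bounded N i phiB sphi).
have eR := orthonormalisation_bounded oR (fun i _ => edgeR_bounded N i phiB sphi).
have DL x : `[0, +oo[%classic x -> `[0, +oo[%classic (2 * x : R).
  by rewrite /= !in_itv/= !andbT => x0; rewrite mulr_ge0.
have DR x : `]-oo, 0]%classic x -> `]-oo, 0]%classic (2 * x : R).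
  by rewrite /= !in_itv/= => x0; rewrite mulr_ge0_le0.
have wL := orthonormalisation_bounded oL' (fun k => @edge_wavelet_bounded _ _ N fL k L0 DL eL).
have wR := orthonormalisation_bounded oR' (fun k => @edge_wavelet_bounded _ _ N fR k L0 DR eR).
have [BL HL] := bounded_within_uniform wL.
have [BR HR] := bounded_within_uniform wR.
(* The absolute values ensure [0 <= B]: for [N = 0] the bounds of the empty edge families are
   arbitrary. *)
pose B := Num.max `|Bpsi| (Num.max `|BL| `|BR|).
have B0 : 0 <= B by rewrite le_max normr_ge0.
have H0 : bounded_within setT (K + N)%:R B psi.
  by apply: bounded_within_le Hpsi; rewrite le_max ler_norm.
have H1 k : (k < N)%N -> bounded_within `[0, +oo[ (K + N)%:R B (gL k).
  by move=> /HL; apply: bounded_within_le; rewrite !le_max ler_norm orbT.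
have H2 k : (k < N)%N -> bounded_within `]-oo, 0] (K + N)%:R B (gR k).
  by move=> /HR; apply: bounded_within_le; rewrite !le_max ler_norm !orbT.
set L := (K + N)%N in L0 KL LK Hphi Hpsi eL eR wL wR HL HR H0 H1 H2.
(* The count has [N] for each edge and [2 L + 1] for the interior; it also exceeds the rescaled
   support length [2 L]. The added 1 makes [C] positive. *)
pose C := B * (N + N + (2 * L).+1)%:R + 1.
have BC1 : B * (N + N + (2 * L).+1)%:R <= C by rewrite lerDl.
have BC2 : B * (2 * L%:R) <= C.
  apply: le_trans BC1; rewrite ler_wpM2l// -natrM ler_nat; lia.
exists C; first by rewrite ltr_wpDl// mulr_ge0.
split=> [l x x01|l k jl kl].
  apply: (@le_trans _ _ (B * 2 `^ (l%:R / 2) * (N + N + (2 * L).+1)%:R)); last first.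
    by rewrite mulrAC ler_wpM2r ?powR_ge0.
  pose m := Num.truncn (2 ^+ l * x).
  apply: (@le_trans _ _ (\sum_(k < 2 ^ l) B * 2 `^ (l%:R / 2) *
    ((0 <= k < 0 + N) + (2 ^ l - N <= k < 2 ^ l - N + N) +
     (m - L <= k < m - L + (2 * L).+1))%:R)).
    by apply: ler_sum => k _; rewrite Epsi; exact: level_function_le.
  rewrite -mulr_sumr ler_wpM2l ?mulr_ge0 ?powR_ge0// -natr_sum ler_nat.
  rewrite !big_split; apply: leq_add; last exact: count_interval.
  by apply: leq_add; [exact: (count_interval _ 0)|exact: count_interval].
have Lpsi : L2 I01 (psi_ l k) by apply: (basisL2 (inr (l, k))); rewrite /= jl kl.
split; first exact: L2_I01_integrable.
have [c Hc] := level_function_supp H0 H1 H2 kl.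
apply: (@le_trans _ _ (B * 2 `^ (l%:R / 2) * (2 * (L%:R / 2 ^+ l)))).
  apply: (@L1_le_supported _ _ c) => //.
  - by rewrite mulr_ge0 ?powR_ge0.
  - by move=> x /=; rewrite in_itv/= Epsi => /Hc[].
  - by move=> x /=; rewrite in_itv/= Epsi => /Hc[].
have p0 : 2 `^ (l%:R / 2) != 0 :> R by rewrite gt_eqF ?powR_gt0.
rewrite -powR2_half powRN.
rewrite (_ : _ * _ = B * (2 * L%:R) * (2 `^ (l%:R / 2))^-1); last by field.
by rewrite ler_wpM2r ?invr_ge0 ?powR_ge0.
Qed.

End edge_bounds.

(** * The C^s norm in terms of coefficients, and the coefficients of a wavelet series *)

Section Cs_norm_facts.
Context {R : realType}.
Context (j0 : nat) (phi_ : nat -> R -> R) (psi_ : nat -> nat -> R -> R) (C : R).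
Implicit Types (c : nat -> nat -> R) (A s q x : R) (f : R -> R).
Local Notation mu := (@lebesgue_measure R).
Local Notation I01 := (`[0, 1]%classic : set R).
Context (ortho : Defs.orthonormal I01 (wavelet_index j0) (wavelet_family phi_ psi_)).
Context (C0 : 0 < C) (supC : sup_bounded psi_ C) (L1C : L1_bounded j0 psi_ C).

Lemma powR2_expN s l : 2 `^ (- (l%:R * s)) = (2 `^ (- s)) ^+ l.
Proof. by rewrite -powR_mulrn ?powR_ge0// -powRrM mulrC mulNr. Qed.

Lemma powR2N_itv s : 0 < s -> 0 < 2 `^ (- s) < 1.
Proof.
move=> s0; rewrite powR_gt0//= powRN invf_lt1 ?powR_gt0//.
by have := @gt0_ltr_powR R s s0 1 2; rewrite powR1 !nnegrE; apply; rewrite ?ltr1n.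
Qed.

Lemma Cs_weightE s l : 2 `^ (l%:R * (s + 2^-1)) =
  ((2 `^ (- s)) ^+ l * 2 `^ (- (l%:R / 2)))^-1.
Proof.
rewrite -powR2_expN -powRD; last by rewrite pnatr_eq0 implybT.
by rewrite -powRN; congr (_ `^ _); ring.
Qed.

(** Passes between the weight in the norm and the normalisation of [coef_bounded]. *)
Lemma Cs_weightM s l y A :
  (2 `^ (l%:R * (s + 2^-1)) * y <= A) =
  (y <= A * ((2 `^ (- s)) ^+ l * 2 `^ (- (l%:R / 2)))).
Proof.
by rewrite Cs_weightE mulrC ler_pdivrMr// mulr_gt0 ?exprn_gt0 ?powR_gt0.
Qed.

Lemma Cs_norm_leP s f A : (Cs_norm j0 phi_ psi_ s f <= A%:E)%E <->
  (forall k, (k < 2 ^ j0)%N -> `|alpha phi_ f k| <= A) /\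
  (forall n, coef_bounded (beta psi_ f) A (2 `^ (- s)) j0 n).
Proof.
rewrite /Cs_norm ge_max; split.
  move=> /andP[H1 H2]; split.
    by move=> k kj; rewrite -lee_fin; apply: le_trans H1; apply: ereal_sup_ubound; exists k.
  move=> n l k /andP[jl _] kl; rewrite -Cs_weightM -lee_fin; apply: le_trans H2; apply: ereal_sup_ubound.
  by exists l, k.
move=> [H1 H2]; apply/andP; split; apply: ge_ereal_sup => z.
  by case=> k kj ->; rewrite lee_fin H1.
case=> l [k [jl kl ->]]; rewrite lee_fin Cs_weightM.
by apply: (H2 l.+1) => //; rewrite jl ltnSn.
Qed.

Lemma Cs_norm_ge s f l k A : (j0 <= l)%N -> (k < 2 ^ l)%N ->
  (A%:E <= (2 `^ (l%:R * (s + 2^-1)) * `|beta psi_ f l k|)%:E)%E ->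
  (A%:E <= Cs_norm j0 phi_ psi_ s f)%E.
Proof.
move=> jl kl /le_trans; apply; rewrite /Cs_norm le_max; apply/orP; right.
by apply: ereal_sup_ubound; exists l, k.
Qed.

Lemma Cs_coef_bounded s f : Cs j0 phi_ psi_ s f ->
  exists2 A, 0 <= A & forall n, coef_bounded (beta psi_ f) A (2 `^ (- s)) j0 n.
Proof.
move=> [_ fin].
have [A A0 fA] : exists2 A : R, 0 <= A & (Cs_norm j0 phi_ psi_ s f <= A%:E)%E.
  move: fin; case: (Cs_norm _ _ _ _ _) => [r _||_] //; last by exists 0; rewrite ?leNye.
  by exists `|r|; rewrite // lee_fin ler_norm.
by exists A => //; have [_] := (Cs_norm_leP s f A).1 fA.
Qed.

Lemma sup_norm01_leP f (B : R) : (sup_norm01 f <= B%:E)%E <->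
  forall x, 0 <= x <= 1 -> `|f x| <= B.
Proof.
split=> [H x x01|H].
  by rewrite -lee_fin; apply: le_trans H; apply: ereal_sup_ubound; exists x.
by apply: ge_ereal_sup => z [x x01 ->]; rewrite lee_fin H.
Qed.

Lemma tailE f i x : (j0 < i)%N ->
  tail j0 phi_ psi_ f i x = wavelet_lim psi_ (beta psi_ f) i x.
Proof. by move=> ji; rewrite /tail gtn_eqF// add0r. Qed.

Let mI01 : measurable (I01 : set (measurableTypeR R)).
Proof. exact: measurable_itv. Qed.

(** The coarse part, present when [i = j0], is orthogonal to the wavelets. Norms of blocks thus
    control the coefficients of [f] itself, and conversely. *)
Lemma beta_block f i n l k : (j0 <= i)%N -> (i <= l <= n)%N -> (k < 2 ^ l)%N ->
  beta psi_ (block j0 phi_ psi_ f i n) l k = beta psi_ f l k.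
Proof.
move=> ji /andP[il ln] kl; have jl := leq_trans ji il.
have Lp := psi_L2 ortho jl kl.
have LW := (wavelet_sum_L2_ip ortho (beta psi_ f) n.+1 ji Lp).1.
have EW : ip I01 (wavelet_sum psi_ (beta psi_ f) i n.+1) (psi_ l k) = beta psi_ f l k.
  by rewrite (ip_wavelet_sum_psi ortho)// il ltnS ln.
have [Lc Ec] : L2 I01 (coarse_part j0 phi_ f) /\
    ip I01 (coarse_part j0 phi_ f) (psi_ l k) = 0.
  have Lphi (k' : 'I_(2 ^ j0)) : k' \in index_enum 'I_(2 ^ j0) -> L2 I01 (phi_ k').
    by move=> _; exact: (phi_L2 ortho).
  have [L1 E1] := L2_ip_sum (fun k' : 'I_(2 ^ j0) => alpha phi_ f k') mI01 Lphi Lp.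
  split; first exact: L1.
  rewrite /coarse_part E1 big1// => k' _.
  by rewrite (ip_phi_psi ortho)// mulr0.
rewrite /beta; set u := if i == j0 then coarse_part j0 phi_ f else (fun=> 0).
have -> : block j0 phi_ psi_ f i n =
    (fun x => 1 * u x + wavelet_sum psi_ (beta psi_ f) i n.+1 x).
  by apply/funext => x; rewrite /block /u mul1r; case: ifP.
have [Lu Eu] : L2 I01 u /\ ip I01 u (psi_ l k) = 0.
  by rewrite /u; case: ifP => _; [|split; [exact: L2_cst0|exact: ip0f]].
by rewrite ip_lin// Eu mulr0 add0r.
Qed.

(** Lets estimates on partial sums, valid up to a geometric error, pass to the limit. *)
Lemma le_of_geometric (y a K q : R) n0 : 0 <= q < 1 ->
  (forall n, (n0 <= n)%N -> y <= a + K * q ^+ n) -> y <= a.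
Proof.
move=> /andP[q0 q1] H.
have cv : a + K * q ^+ n @[n --> \oo] --> a + K * 0.
  apply: cvgD; first exact: cvg_cst.
  by apply: cvgMr; apply: cvg_expr; rewrite ger0_norm.
rewrite mulr0 addr0 in cv.
rewrite -(cvg_lim _ cv)//; apply: limr_ge; first by apply/cvg_ex; exists a.
by near=> n; apply: H; near: n; exists n0.
Unshelve. all: by end_near. Qed.

Lemma ip_psi_le f (B : R) l k : (j0 <= l)%N -> (k < 2 ^ l)%N -> L2 I01 f ->
  0 <= B -> (forall x, 0 <= x <= 1 -> `|f x| <= B) ->
  `|ip I01 f (psi_ l k)| <= B * C * 2 `^ (- (l%:R / 2)).
Proof.
move=> jl kl Lf B0 fB; have [ipsi bpsi] := L1C jl kl.
apply: (@le_trans _ _ (B * \int[mu]_(x in I01) `|psi_ l k x|)).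
  by apply: ip_le => //; exact: (psi_L2 ortho).
by rewrite -mulrA ler_wpM2l.
Qed.

(* The partial sums of the tail eventually have coefficient [c l k] at (l, k)
   and converge to it uniformly, so no exchange of limit and integral is
   needed. *)
Lemma coef_le_lim c A q i l k B : 0 <= A -> 0 <= q < 1 -> (j0 <= i <= l)%N ->
  (k < 2 ^ l)%N -> (forall n, coef_bounded c A q j0 n) -> 0 <= B ->
  (forall x, 0 <= x <= 1 -> `|wavelet_lim psi_ c i x| <= B) ->
  `|c l k| <= B * C * 2 `^ (- (l%:R / 2)).
Proof.
move=> A0 q01 /andP[ji il] kl cA B0 HB.
have jl := leq_trans ji il; have Lp := psi_L2 ortho jl kl.
have q1 : 0 < 1 - q by rewrite subr_gt0; case/andP: q01.
have q0 : 0 <= q by case/andP: q01.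
set p := 2 `^ _.
apply: (@le_of_geometric _ _ (A * C / (1 - q) * C * p) q l.+1) => // n ln.
have cAn n' : coef_bounded c A q n n'.
  by apply: coef_bounded_sub (cA n') => //; exact: leq_trans (ltnW ln).
(* The partial sum differs from the limit by the tail from level [n], which is O(q ^ n). *)
have WB x : 0 <= x <= 1 ->
    `|wavelet_sum psi_ c i n x| <= B + A * C * (q ^+ n / (1 - q)).
  move=> x01; have inn := leq_trans il (ltnW ln).
  have E := wavelet_lim_split A0 (ltW C0) q01 supC cAn x01 inn.
  have -> : wavelet_sum psi_ c i n x = wavelet_lim psi_ c i x - wavelet_lim psi_ c n x.
    by rewrite E addrK.
  rewrite (le_trans (ler_normB _ _))// lerD ?HB//.
  exact: (wavelet_lim_le A0 (ltW C0) q01 supC).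
have D0 : 0 <= B + A * C * (q ^+ n / (1 - q)).
  by rewrite addr_ge0 ?mulr_ge0 ?(ltW C0) ?invr_ge0 ?(ltW q1) ?exprn_ge0.
have := @ip_psi_le _ _ l k jl kl (wavelet_sum_L2_ip ortho c n ji Lp).1 D0 WB.
rewrite (ip_wavelet_sum_psi ortho)// il ln => /le_trans; apply.
rewrite -/p le_eqVlt; apply/orP; left; apply/eqP; field.
by rewrite gt_eqF.
Qed.

(** Supplies the function of part (b) from its coefficients. The limit is bounded, hence
    square-integrable, and its inner product with a basis function is the limit of an eventually
    constant sequence. *)
Lemma wavelet_lim_coef c A q : 0 <= A -> 0 <= q < 1 ->
  (forall n, coef_bounded c A q j0 n) ->
  let F := wavelet_lim psi_ c j0 in
  [/\ L2 I01 F, forall k, (k < 2 ^ j0)%N -> alpha phi_ F k = 0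
    & forall l k, (j0 <= l)%N -> (k < 2 ^ l)%N -> beta psi_ F l k = c l k].
Proof.
move=> A0 q01 cA F.
have q1 : 0 < 1 - q by rewrite subr_gt0; case/andP: q01.
have q0 : 0 <= q by case/andP: q01.
pose W := wavelet_sum psi_ c j0.
have j0j0 : (0 < 2 ^ j0)%N by rewrite expn_gt0.
(* [phi_ 0] merely serves as some square-integrable [g]. *)
have LW n : L2 I01 (W n) by exact: (wavelet_sum_L2_ip ortho c n _ (phi_L2 ortho j0j0)).1.
have mF : measurable_fun I01 F.
  apply: (measurable_fun_cvg (h := W)) => [m|x]; first by case: (LW m).
  rewrite /= in_itv/= => x01.
  exact: (wavelet_sum_cvg A0 (ltW C0) q01 supC cA x01).
have LF : L2 I01 F.
  split => //.
  pose K := (A * C * (q ^+ j0 / (1 - q))) ^+ 2.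
  apply: (@le_lt_trans _ _ (\int[mu]_(x in I01) (cst K%:E) x)%E).
    apply: ge0_le_integral => //.
    - by move=> x _; rewrite lee_fin sqr_ge0.
    - by apply/measurable_EFinP; exact: measurable_funX.
    - move=> x /=; rewrite in_itv/= => x01; rewrite lee_fin -[_ ^+ 2]ger0_norm ?sqr_ge0//.
      have K0 : 0 <= A * C * (q ^+ j0 / (1 - q)).
        by rewrite !mulr_ge0 ?(ltW C0) ?invr_ge0 ?(ltW q1) ?exprn_ge0.
      rewrite normrX ler_pXn2r ?nnegrE//.
      exact: (wavelet_lim_le A0 (ltW C0) q01 supC cA x01).
  rewrite integral_cst//; have : (K%:E * mu I01 < +oo)%E; last by [].
  by rewrite lebesgue_measure_itv/= lte_fin ltr01 -EFinB -EFinM ltry.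
(* The difference from the partial sum is uniformly O(q ^ n), so pairing it with an integrable [g]
   costs only the L^1 norm of [g]. *)
have close g n v : (j0 <= n)%N -> L2 I01 g -> ip I01 (W n) g = v ->
    `|ip I01 F g - v| <=
    A * C * (q ^+ n / (1 - q)) * \int[mu]_(x in I01) `|g x|.
  move=> jn Lg <-.
  have -> : ip I01 F g - ip I01 (W n) g = ip I01 (fun x => -1 * W n x + F x) g.
    by rewrite ip_lin// mulN1r addrC.
  apply: ip_le => //; [exact: L2_lin|exact: L2_I01_integrable|].
  move=> x /=; rewrite in_itv/= => x01.
  have cAn n' : coef_bounded c A q n n' by apply: coef_bounded_sub (cA n').
  rewrite /F (wavelet_lim_split A0 (ltW C0) q01 supC cAn x01 jn) mulN1r addKr.
  exact: (wavelet_lim_le A0 (ltW C0) q01 supC cAn x01).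
have lim g n0 v : L2 I01 g -> (j0 <= n0)%N ->
    (forall n, (n0 <= n)%N -> ip I01 (W n) g = v) -> ip I01 F g = v.
  move=> Lg jn0 H; apply/eqP; rewrite -subr_eq0 -normr_le0.
  apply: (@le_of_geometric _ _ (A * C / (1 - q) * \int[mu]_(x in I01) `|g x|) q n0) => //.
  move=> n nn; apply: le_trans (close g n v (leq_trans jn0 nn) Lg (H n nn)) _.
  rewrite add0r le_eqVlt; apply/orP; left; apply/eqP; field.
  by rewrite gt_eqF.
split=> // [k kj|l k jl kl].
  apply: (lim _ j0) => //; first exact: (phi_L2 ortho).
  by move=> n _; exact: (ip_wavelet_sum_phi ortho).
(* Level [l] belongs to the partial sum [W n] once [n > l]. *)
apply: (lim _ l.+1) => //; [exact: (psi_L2 ortho)|exact: leq_trans jl _|].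
by move=> n ln; rewrite (ip_wavelet_sum_psi ortho)// jl ln.
Qed.

End Cs_norm_facts.

(** * Decay of the tails against self-similarity *)

Section decay_and_self_similarity.
Context {R : realType}.
Context (j0 : nat) (phi_ : nat -> R -> R) (psi_ : nat -> nat -> R -> R) (C : R).
Local Notation I01 := (`[0, 1]%classic : set R).
Context (ortho : Defs.orthonormal I01 (wavelet_index j0) (wavelet_family phi_ psi_)).
Context (C0 : 0 < C) (supC : sup_bounded psi_ C) (L1C : L1_bounded j0 psi_ C).
Context (j0_gt0 : (0 < j0)%N).

(** Up to level [j1] the ball of C^smin gives the bound, at the cost of a factor 2 ^ (j1 smax);
    above [j1] the tail bound gives it, at the cost of 2 ^ smax. The radius does not depend on
    [s]. *)
Lemma decay_Cs_ball (s smin smax b b1 b2 : R) j1 f :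
  0 < smin <= s -> s <= smax -> 0 < b -> 0 < b2 -> (j0 <= j1)%N ->
  decay_condition j0 phi_ psi_ s smin b b1 b2 j1 f ->
  Cs_ball j0 phi_ psi_ s (b * 2 `^ (j1%:R * smax) + b2 * C * 2 `^ smax) f.
Proof.
move=> /andP[smin0 smins] ssmax b0 b20 j01 [Csf [Lf bf] dec]; split => //.
set M := _ + _.
have s0 : 0 < s by exact: lt_le_trans smins.
have /andP[q0 q1] := powR2N_itv s0; set q := 2 `^ (- s) in q0 q1.
have [A A0 cA] := Cs_coef_bounded Csf.
have T0 : 0 < b2 * C * 2 `^ smax by rewrite !mulr_gt0 ?powR_gt0.
have bM : b * 2 `^ (j1%:R * smax) <= M by rewrite lerDl ltW.
have cM : b2 * C * 2 `^ smax <= M by rewrite lerDr mulr_ge0 ?powR_ge0 ?ltW.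
have [bal bbe] := (Cs_norm_leP j0 phi_ psi_ smin f b).1 bf.
apply/Cs_norm_leP; split.
  move=> k /bal /le_trans; apply; apply: le_trans bM.
  rewrite ler_pMr// -[leLHS](powRr0 2) ler_powR ?ler1n// mulr_ge0//.
  by apply: le_trans ssmax; exact: ltW.
move=> n l k /andP[jl _] kl; have [lj1|j1l] := leqP l j1.
  have ln : (j0 <= l < l.+1)%N by rewrite jl ltnSn.
  apply: le_trans (bbe l.+1 l k ln kl) _.
  apply: (@le_trans _ _ (b * 2 `^ (j1%:R * smax) * (q ^+ l * 2 `^ (- (l%:R / 2))))).
    rewrite -[leRHS]mulrA ler_wpM2l ?(ltW b0)// mulrA ler_wpM2r ?powR_ge0//.
    rewrite -!powR2_expN -powRD; last by rewrite pnatr_eq0 implybT.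
    rewrite ler_powR ?ler1n//.
    have : l%:R * (s - smin) <= j1%:R * smax.
      by rewrite ler_pM ?ler_nat//; lra.
    by lra.
  by rewrite ler_wpM2r// mulr_ge0 ?exprn_ge0 ?powR_ge0// ltW.
have l0 : (0 < l)%N by exact: leq_ltn_trans j1l.
have j1l' : (j1 <= l.-1)%N by rewrite -ltnS prednK.
(* The tail starting at level [l] is governed by the decay condition at [l - 1]; the lost factor 2 ^
   s is at most 2 ^ smax. *)
have [_ ub] := dec l.-1 j1l'.
have B0 : 0 <= b2 * q ^+ l.-1 by rewrite mulr_ge0 ?exprn_ge0 ?ltW.
have jll : (j0 <= l <= l)%N by rewrite jl leqnn.
apply: le_trans (coef_le_lim ortho C0 supC L1C A0 _ jll kl cA B0 _) _.
- by rewrite ltW.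
- move=> x x01; rewrite -(@tailE _ j0 phi_); last exact: leq_ltn_trans j1l.
  rewrite prednK// powR2_expN in ub.
  exact: (sup_norm01_leP _ _).1 ub x x01.
rewrite mulrA ler_wpM2r ?powR_ge0//.
apply: le_trans (ler_wpM2r _ cM); last by rewrite exprn_ge0 ?ltW.
have pq : 1 <= 2 `^ smax * q.
  rewrite -[leLHS](powRr0 2) -powRD; last by rewrite pnatr_eq0 implybT.
  by rewrite ler_powR ?ler1n//; lra.
have -> : q ^+ l = q * q ^+ l.-1 by rewrite -exprS prednK.
rewrite -[leLHS]mulr1.
rewrite (_ : _ * (q * _) = b2 * q ^+ l.-1 * C * (2 `^ smax * q)); last by ring.
by rewrite ler_wpM2l// mulr_ge0// (ltW C0).
Qed.

(* If all the coefficients at levels [j, rho j] were small, then the tail from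
   level [max j j1 + 1] would be too small. *)
Lemma decay_block_large (s smin b b1 b2 M eps : R) j1 r j f :
  0 < smin <= s -> 0 < M -> 0 < eps -> (j0 <= j1)%N -> 0 < b1 ->
  let q0 := 2 `^ (- smin) in
  eps * M * (C / (1 - q0)) <= b1 / 4 ->
  M * (C / (1 - q0)) * q0 ^+ r <= b1 / 4 ->
  Cs_ball j0 phi_ psi_ s M f ->
  decay_condition j0 phi_ psi_ s smin b b1 b2 j1 f ->
  (j0 <= j)%N ->
  ((eps * M)%:E <= Cs_norm j0 phi_ psi_ s (block j0 phi_ psi_ f j ((j1 + r) * j)))%E.
Proof.
move=> /andP[smin0 smins] M0 eps0 j01 b10 q0 epsM rM [_ fM] [_ _ dec] jj.
have s0 : 0 < s by exact: lt_le_trans smins.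
have /andP[qp q1] := powR2N_itv s0; set q := 2 `^ (- s) in qp q1.
have /andP[q0p q01] := powR2N_itv smin0; rewrite -/q0 in q0p q01.
have qq0 : q <= q0 by rewrite ler_powR ?ler1n// lerN2.
have [_ cM] := (Cs_norm_leP j0 phi_ psi_ s f M).1 fM.
set n := ((j1 + r) * j)%N; rewrite leNgt; apply/negP => small.
pose d := eps * M; have d0 : 0 < d by rewrite mulr_gt0.
(* A small block forces every coefficient of [f] in the window below the bound with constant
   [eps * M]. *)
have cd : coef_bounded (beta psi_ f) d q j n.+1.
  move=> l k /andP[jl]; rewrite ltnS => ln kl; have j0l := leq_trans jj jl.
  have jln : (j <= l <= n)%N by rewrite jl ln.
  rewrite -Cs_weightM leNgt; apply/negP => big.
  suff : (d%:E <= Cs_norm j0 phi_ psi_ s (block j0 phi_ psi_ f j n))%E.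
    by rewrite leNgt small.
  apply: (Cs_norm_ge _ j0l kl).
  by rewrite (beta_block ortho)// lee_fin ltW.
(* The decay condition is available from [j1] on only. As [j] and [j1] are positive, (j1 + r) j is
   at least [m + r], so the window reaches [r] levels past [m]. *)
pose m := maxn j j1.
have jp : (0 < j)%N by exact: leq_trans jj.
have j1p : (0 < j1)%N by exact: leq_trans j01.
have mn : (m + r <= n)%N.
  by rewrite /m /n mulnDl leq_add ?geq_max ?leq_pmull ?leq_pmulr.
have [lb _] := dec m (leq_maxr _ _).
have j0m : (j0 < m.+1)%N by rewrite ltnS leq_max jj.
suff : (sup_norm01 (tail j0 phi_ psi_ f m.+1) <= (b1 / 2 * q ^+ m)%:E)%E.
  move=> /(le_trans lb); rewrite powR2_expN lee_fin -/q.
  have : 0 < b1 * q ^+ m by rewrite mulr_gt0 ?exprn_gt0.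
  by lra.
apply/sup_norm01_leP => x x01; rewrite tailE//.
have mlen : (m <= n)%N by exact: leq_trans (leq_addr r m) mn.
have q_itv : 0 <= q < 1 by rewrite ltW.
have cMn n' : coef_bounded (beta psi_ f) M q n.+1 n'.
  apply: coef_bounded_sub (cM n') => //; apply: leq_trans jj _.
  by rewrite leqW// (leq_trans (leq_maxl j j1) mlen).
(* Levels [m + 1] to [n] have small coefficients; those beyond [n] carry the constant [M] but gain
   [q0 ^+ r]. Each piece is at most a quarter of the lower bound. *)
rewrite (wavelet_lim_split (ltW M0) (ltW C0) q_itv supC cMn x01 (mlen : (m.+1 <= n.+1)%N)).
have cd' : coef_bounded (beta psi_ f) d q m.+1 n.+1.
  by apply: coef_bounded_sub cd => //; rewrite leqW ?leq_maxl.
have H1 := wavelet_sum_le (ltW d0) (ltW C0) q_itv supC cd' x01.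
have H2 := wavelet_lim_le (ltW M0) (ltW C0) q_itv supC cMn x01.
apply: le_trans (ler_normD _ _) _; apply: le_trans (lerD H1 H2) _.
(* Replacing [q] by [q0] makes the constants uniform over [s >= smin]. *)
have inv : C / (1 - q) <= C / (1 - q0).
  by rewrite ler_pM2l// lef_pV2 ?posrE ?subr_gt0// lerD2l lerN2.
have G0 : 0 < C / (1 - q0) by rewrite divr_gt0// subr_gt0.
have Cq0 : 0 < C / (1 - q) by rewrite divr_gt0// subr_gt0.
have qm0 : 0 <= q ^+ m by rewrite exprn_ge0 ?ltW.
have E1 : d * C * (q ^+ m.+1 / (1 - q)) <= b1 / 4 * q ^+ m.
  rewrite (_ : _ * _ = d * (C / (1 - q)) * q ^+ m.+1); last by ring.
  apply: ler_pM.
  - exact: mulr_ge0 (ltW d0) (ltW Cq0).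
  - by rewrite exprn_ge0 ?ltW.
  - exact: le_trans (ler_wpM2l (ltW d0) inv) epsM.
  - by rewrite exprS ler_piMl// ltW.
have E2 : M * C * (q ^+ n.+1 / (1 - q)) <= b1 / 4 * q ^+ m.
  rewrite (_ : _ * _ = M * (C / (1 - q)) * q ^+ n.+1); last by ring.
  apply: le_trans (ler_wpM2r qm0 rM); rewrite -mulrA -2![leRHS]mulrA; apply: ler_pM.
  - exact: ltW.
  - by rewrite mulr_ge0 ?(ltW Cq0)// exprn_ge0// ltW.
  - by [].
  apply: ler_pM => //.
  - exact: ltW.
  - by rewrite exprn_ge0 ?ltW.
  apply: (@le_trans _ _ (q ^+ (r + m))).
    by apply: ler_wiXn2l; rewrite ?(ltW qp) ?(ltW q1)// addnC leqW.
  by rewrite exprD; apply: ler_wpM2r => //; apply: lerXn2r => //; exact: ltW.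
lra.
Qed.

(** The least [i] with j <= j0 2 ^ i works: if it is positive, minimality gives j0 2 ^ i < 2 j,
    which is at most rho j. *)
Lemma exists_level_in_window rho j : (1 < rho)%N -> (j0 <= j)%N ->
  exists i, (j <= j0 * 2 ^ i <= rho * j)%N.
Proof.
move=> rho1 jj.
have ex : exists i, (j <= j0 * 2 ^ i)%N.
  exists j; apply: (@leq_trans (2 ^ j)); first exact/ltnW/ltn_expl.
  by rewrite leq_pmull.
case: (ex_minnP ex) => [[|i] ji min].
  by exists 0%N; rewrite ji/= expn0 muln1; apply: leq_trans jj _; rewrite leq_pmull// ltnW.
exists i.+1; rewrite ji/=.
have lti : (j0 * 2 ^ i < j)%N by rewrite ltnNge; apply/negP => /min; rewrite ltnn.
by rewrite expnS; apply: (@leq_trans (2 * j)); [lia|rewrite leq_mul2r rho1 orbT].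
Qed.

Lemma lacunary_function (smax s M eps : R) rho :
  0 < s <= smax -> 0 < M -> 0 < eps < 1 -> (1 < rho)%N ->
  exists2 f : R -> R, self_similar j0 phi_ psi_ smax s M eps rho f
    & forall (smin b b1 b2 : R) j1, 0 < b1 ->
        ~ decay_condition j0 phi_ psi_ s smin b b1 b2 j1 f.
Proof.
move=> /andP[s0 ssmax] M0 /andP[eps0 eps1] rho1.
have /andP[qp q1] := powR2N_itv s0; set q := 2 `^ (- s) in qp q1.
have q_itv : 0 <= q < 1 by rewrite ltW.
(* The non-zero coefficients attain the bound of the ball of radius [M]. *)
pose c l k : R := if (k == 0%N) && `[< exists i, l = (j0 * 2 ^ i)%N >]
  then M * (q ^+ l * 2 `^ (- (l%:R / 2))) else 0.
have w0 l : 0 < q ^+ l * 2 `^ (- (l%:R / 2)) by rewrite mulr_gt0 ?exprn_gt0 ?powR_gt0.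
have cM n : coef_bounded c M q j0 n.
  move=> l k _ _; rewrite /c; case: ifP => _; last by rewrite normr0 mulr_ge0 ?ltW.
  by rewrite ger0_norm// mulr_ge0 ?ltW.
have [LF aF bF] := wavelet_lim_coef ortho C0 supC (ltW M0) q_itv cM.
set F := wavelet_lim psi_ c j0 in LF aF bF.
have ball : Cs_ball j0 phi_ psi_ s M F.
  split => //; apply/Cs_norm_leP; split.
    by move=> k kj; rewrite aF// normr0 ltW.
  move=> n l k /andP[jl ln] kl; rewrite bF//; apply: (cM n) => //.
  by rewrite jl ln.
have large j : (j0 <= j)%N ->
    ((eps * M)%:E <= Cs_norm j0 phi_ psi_ s (block j0 phi_ psi_ F j (rho * j)))%E.
  move=> jj; have [i jin] := exists_level_in_window rho1 jj.
  have jl : (j0 <= j0 * 2 ^ i)%N by rewrite leq_pmulr// expn_gt0.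
  apply: (Cs_norm_ge (k := 0) _ jl); first by rewrite expn_gt0.
  rewrite (beta_block ortho) ?expn_gt0// bF ?expn_gt0// lee_fin /c eqxx/=.
  rewrite asboolT; last by exists i.
  apply: (@le_trans _ _ M); first by rewrite ler_piMl ?ltW.
  rewrite ger0_norm; last exact: mulr_ge0 (ltW M0) (ltW (w0 _)).
  by rewrite Cs_weightE -/q mulrCA mulVf ?mulr1// gt_eqF.
exists F.
  by split=> [//|_|_]; [exact: large|exact: large].
move=> smin b b1 b2 j1 b10 [_ _ dec].
(* The lower bound at level [l] would require b1 q ^ l <= M C / (1 - q) q ^ (2 l), which fails once
   [l] is large. *)
have cvK : M * C / (1 - q) * q ^+ n @[n --> \oo] --> M * C / (1 - q) * 0.
  by apply: cvgMr; apply: cvg_expr; rewrite ger0_norm// ltW.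
rewrite mulr0 in cvK.
have [n0 _ small] : \forall n \near \oo, M * C / (1 - q) * q ^+ n < b1.
  exact: cvgr_lt cvK _ b10.
(* As [l >= i], this level is past both [j1] and the threshold [n0]. *)
pose i := maxn n0 j1; pose l := (j0 * 2 ^ i)%N.
have il : (i <= l)%N.
  by apply: (@leq_trans (2 ^ i)); [exact/ltnW/ltn_expl|rewrite leq_pmull].
have jl : (j0 <= l)%N by rewrite leq_pmulr// expn_gt0.
have [lb _] := dec l (leq_trans (leq_maxr n0 j1) il).
have sm : M * C / (1 - q) * q ^+ l < b1.
  by apply: small; exact: leq_trans (leq_maxl n0 j1) il.
have lp : (0 < l)%N by exact: leq_trans jl.
have bFM n n' : (j0 <= n)%N -> coef_bounded (beta psi_ F) M q n n'.
  move=> jn l' k /andP[nl' l'n'] kl'; have jl' := leq_trans jn nl'.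
  by rewrite bF//; apply: (cM n') => //; rewrite jl' l'n'.
(* No power of two lies strictly between [2 ^ i] and [2 ^ i.+1]. *)
have bF0 : coef_bounded (beta psi_ F) 0 q l.+1 (2 * l).
  move=> l' k /andP[ll' l'l] kl'; rewrite bF//; last exact: leq_trans jl (ltnW ll').
  rewrite /c; case: ifPn => [/andP[_ /asboolP[i' El']]|_]; last by rewrite normr0 mul0r.
  move: ll' l'l; rewrite El' /l mulnCA -expnS !ltn_pmul2l// !ltn_exp2l//.
  by move=> ii' i'i; move: (leq_ltn_trans ii' i'i); rewrite ltnn.
suff : (sup_norm01 (tail j0 phi_ psi_ F l.+1) <= (M * C / (1 - q) * q ^+ l * q ^+ l)%:E)%E.
  move=> /(le_trans lb); rewrite powR2_expN lee_fin -/q ler_pM2r ?exprn_gt0//.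
  by rewrite leNgt sm.
apply/sup_norm01_leP => x x01; rewrite tailE ?ltnS//.
have l2l : (l.+1 <= 2 * l)%N by rewrite mul2n -addnn -[l.+1]addn1 leq_add2l.
have jl2 : (j0 <= 2 * l)%N by apply: leq_trans l2l; exact: leqW.
have b2l n := bFM (2 * l)%N n jl2.
(* The next non-zero level after [l] is [2 * l], so the sum over the gap vanishes. *)
rewrite (wavelet_lim_split (ltW M0) (ltW C0) q_itv supC b2l x01 l2l).
have := wavelet_sum_le (lexx 0) (ltW C0) q_itv supC bF0 x01.
rewrite !mul0r normr_le0 => /eqP ->; rewrite add0r.
apply: le_trans (wavelet_lim_le (ltW M0) (ltW C0) q_itv supC b2l x01) _.
by rewrite mul2n -addnn exprD le_eqVlt; apply/orP; left; apply/eqP; ring.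
Qed.

End decay_and_self_similarity.

(** * Choice of the constants and conclusion *)

Theorem proposition2p2 (R : realType) (K N j0 : nat) (phi psi : R -> R)
    (phi_ : nat -> R -> R) (psi_ : nat -> nat -> R -> R) (smax : R)
    (phi_psi_mra : scaling_wavelet_pair phi psi)
    (phi_supp : supported_in (1 - K%:R) K%:R phi)
    (psi_supp : supported_in (1 - K%:R) K%:R psi)
    (psi_moments : vanishing_moments N psi)
    (phi_C2 : twice_continuously_differentiable phi)
    (psi_continuous : continuous psi)
    (basis : cdv_basis K N j0 phi psi phi_ psi_)
    (smax_range : 0 < smax < N%:R) :
  (forall (smin b b1 b2 : R) (j1 : nat),
     0 < smin <= smax -> 0 < b -> 0 < b1 <= b2 -> (j0 <= j1)%N ->
     exists (M eps : R) (rho : nat),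
       [/\ 0 < M, 0 < eps < 1, (0 < rho)%N
         & forall s : R, smin <= s <= smax ->
           forall f : R -> R,
             decay_condition j0 phi_ psi_ s smin b b1 b2 j1 f ->
             self_similar j0 phi_ psi_ smax s M eps rho f])
  /\
  (forall (s M eps : R) (rho : nat),
     0 < s <= smax -> 0 < M -> 0 < eps < 1 -> (1 < rho)%N ->
     exists2 f : R -> R,
       self_similar j0 phi_ psi_ smax s M eps rho f
       & forall (smin b b1 b2 : R) (j1 : nat),
           0 < smin <= s -> 0 < b -> 0 < b1 <= b2 -> (j0 <= j1)%N ->
           ~ decay_condition j0 phi_ psi_ s smin b b1 b2 j1 f).
Proof.
move: basis => /[dup] cdv [_ [_ [_ [_ [_ _ _ [j0_gt0 _] [ortho _ _]]]]]].
have phi_cont : continuous phi.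
  move=> x; case: phi_C2 => dphi _ _.
  exact/differentiable_continuous/derivable1_diffP/dphi.
have [C C0 [supC L1C]] := cdv_bounds cdv phi_cont psi_continuous phi_supp psi_supp.
split=> [smin b b1 b2 j1 /andP[smin0 smins] b0 /andP[b10 b12] j01|]; last first.
  move=> s M eps rho s_range M0 eps_range rho1.
  have [f f_ss f_nd] :=
    lacunary_function ortho C0 supC j0_gt0 s_range M0 eps_range rho1.
  exists f => // smin b b1 b2 j1 _ _ /andP[b10 _] _; exact: f_nd.
have b20 : 0 < b2 := lt_le_trans b10 b12.
pose M := b * 2 `^ (j1%:R * smax) + b2 * C * 2 `^ smax.
have M0 : 0 < M by rewrite addr_gt0// ?mulr_gt0 ?powR_gt0.
have /andP[q0 q1] := powR2N_itv smin0.
(* The geometric factor at the smallest regularity [smin], where it is largest. *)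
pose G := C / (1 - 2 `^ (- smin)).
have G0 : 0 < G by rewrite divr_gt0// subr_gt0.
have [r rM] : exists r, M * G * (2 `^ (- smin)) ^+ r <= b1 / 4.
  have cv : M * G * (2 `^ (- smin)) ^+ n @[n --> \oo] --> M * G * 0.
    by apply: cvgMr; apply: cvg_expr; rewrite ger0_norm// ltW.
  rewrite mulr0 in cv; have b4 : 0 < b1 / 4 by rewrite divr_gt0.
  have [r _ small] : \forall n \near \oo, M * G * (2 `^ (- smin)) ^+ n < b1 / 4.
    exact: cvgr_lt cv _ b4.
  by exists r; apply/ltW/small => /=.
(* The first term keeps [eps] below 1; the second bounds the contribution of the window by a quarter
   of the lower bound. *)
pose eps := Num.min (1 / 2) (b1 / 4 / (M * G)).
have eps0 : 0 < eps by rewrite lt_min !divr_gt0// mulr_gt0.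
have epsM : eps * M * G <= b1 / 4.
  have MG0 : 0 < M * G by rewrite mulr_gt0.
  have : eps <= b1 / 4 / (M * G) by rewrite /eps ge_min lexx orbT.
  by rewrite (ler_pdivlMr _ _ MG0) mulrA.
exists M, eps, (j1 + r)%N; split=> //.
- rewrite eps0 (@le_lt_trans _ _ (1 / 2))//; first by rewrite /eps ge_min lexx.
  by rewrite ltr_pdivrMr// mul1r ltr1n.
- by apply: leq_trans (leq_addr _ _); exact: leq_trans j01.
move=> s /andP[smins' ssmax] f fdec.
have smin_s : 0 < smin <= s by rewrite smin0.
have ball := decay_Cs_ball ortho C0 supC L1C smin_s ssmax b0 b20 j01 fdec.
have large j : (j0 <= j)%N -> ((eps * M)%:E <=
    Cs_norm j0 phi_ psi_ s (block j0 phi_ psi_ f j ((j1 + r) * j)))%E.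
  by apply: (decay_block_large ortho C0 supC _ smin_s M0 eps0 j01 b10 epsM rM ball fdec).
(* The cases [s < smax] and [s = smax] both follow from the bound at every [j >= j0]. *)
by split=> [//|_|_]; [exact: large|exact: large].
Qed.
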